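(* Let $\mathcal A$ be a Hopf superalgebra over $\mathbb C$. Then $\mathcal A$ admits a left integral $\int$ with $\int 1_{\mathcal A}\neq 0$ if and only if all right $\mathcal A$-comodules are completely reducible.
   Context: All vector spaces are over $\mathbb C$ and $\mathbb Z_2$-graded; all notions are meant in the super sense with the sign rule $(f\otimes g)(a\otimes b)=(-1)^{[g][a]}f(a)\otimes g(b)$. $\mathcal A$ has comultiplication $\Delta$ and unit $1_{\mathcal A}$. A left integral on $\mathcal A$ is a linear form $\int\in\mathcal A^*$ (full linear dual) with $(\mathrm{id}_{\mathcal A}\otimes\int)\Delta(a)=1_{\mathcal A}\int(a)$ for all $a\in\mathcal A$. Right $\mathcal A$-comodules are $\mathbb Z_2$-graded, not necessarily finite-dimensional, with even structure map $\omega:V\to V\otimes\mathcal A$; sub-comodules are graded, and completely reducible means that every (graded) sub-comodule has a (graded) comodule complement. *)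

(* Defs.v *)
From HB Require Import structures.
From mathcomp Require Import all_boot all_algebra.
From mathcomp Require Import boolp reals complex.
From mathcomp.multinomials Require Import freeg.

Set Implicit Arguments.
Unset Strict Implicit.
Unset Printing Implicit Defensive.

Import GRing.Theory.
Local Open Scope ring_scope.
Local Open Scope quotient_scope.

Section LinearSpan.
Variables (F : fieldType) (V : lmodType F).
Implicit Types (S : V -> Prop) (W : {pred V}).

Definition lspan S : {pred V} := fun v =>
  `[< forall W, submod_closed W -> (forall x, S x -> x \in W) -> v \in W >].

Lemma lspan_submod_closed S : submod_closed (lspan S).
Proof.
split=> [|a u v /asboolP Su /asboolP Sv].
  by apply/asboolP => W [].
apply/asboolP => W Wc SW; have [_ Wl] := Wc.
by apply: Wl; [exact: Su | exact: Sv].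
Qed.

Lemma mem_lspan S x : S x -> x \in lspan S.
Proof. by move=> Sx; apply/asboolP => W _; apply. Qed.

Lemma lspan_min S W : submod_closed W -> (forall x, S x -> x \in W) ->
  {subset lspan S <= W}.
Proof. by move=> Wc SW v /asboolP; apply. Qed.

HB.instance Definition _ S :=
  GRing.isSubmodClosed.Build F V (lspan S)
    (GRing.submod_closed_semi (lspan_submod_closed S)).

End LinearSpan.

(* V (x) W is the free F-module on V * W modulo the span of the bilinearity
   relations. *)
Section Tensor.
Variables (F : fieldType) (V W : lmodType F).

Inductive bilinear_relation : {freeg (V * W)%type / F} -> Prop :=
| BilinearRelL a v v' w : bilinear_relation
    (<< (a *: v + v', w) >> - (a *: << (v, w) >> + << (v', w) >>))
| BilinearRelR a v w w' : bilinear_relation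
    (<< (v, a *: w + w') >> - (a *: << (v, w) >> + << (v, w') >>)).

Definition tensor : Type := Quotient.quot (lspan bilinear_relation).

HB.instance Definition _ := GRing.Zmodule.on tensor.
HB.instance Definition _ := ZmodQuotient.on tensor.

Lemma tensor_piE x y :
  (\pi_tensor x = \pi_tensor y) <-> (x - y \in lspan bilinear_relation).
Proof. by rewrite Quotient.idealrBE; split=> /eqP. Qed.

End Tensor.

HB.lock Definition tensor_scale (F : fieldType) (V W : lmodType F) (a : F)
  (t : tensor V W) : tensor V W := \pi_(tensor V W) (a *: repr t).

HB.lock Definition tens (F : fieldType) (V W : lmodType F) (v : V) (w : W) :
  tensor V W := \pi_(tensor V W) << (v, w) >>.

Arguments tensor_scale {F V W} a t.
Arguments tens {F V W} v w.

Section TensorLmodule.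
Variables (F : fieldType) (V W : lmodType F).
Implicit Type t : tensor V W.
Local Notation tensor := (tensor V W).

Lemma tensor_scale_pi a x : tensor_scale a (\pi_tensor x) = \pi_tensor (a *: x).
Proof.
rewrite tensor_scale.unlock; apply/tensor_piE; rewrite -scalerBr rpredZ //.
by apply/tensor_piE; rewrite reprK.
Qed.

Fact tensor_scaleA a b t :
  tensor_scale a (tensor_scale b t) = tensor_scale (a * b) t.
Proof.
by elim/quotW: t => x; rewrite (tensor_scale_pi b) !tensor_scale_pi scalerA.
Qed.

Fact tensor_scale1 : left_id 1 (@tensor_scale F V W).
Proof. by elim/quotW=> x; rewrite tensor_scale_pi scale1r. Qed.

Fact tensor_scaleDr : right_distributive (@tensor_scale F V W) +%R.
Proof.
move=> a; elim/quotW=> x; elim/quotW=> y.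
by rewrite -raddfD !tensor_scale_pi scalerDr raddfD.
Qed.

Fact tensor_scaleDl t : {morph tensor_scale^~ t : a b / a + b}.
Proof.
by elim/quotW: t => x a b; rewrite !tensor_scale_pi scalerDl raddfD.
Qed.

HB.instance Definition _ := GRing.Zmodule_isLmodule.Build F tensor
  tensor_scaleA tensor_scale1 tensor_scaleDr tensor_scaleDl.

Lemma tensor_piZ a x : \pi_tensor (a *: x) = a *: \pi_tensor x.
Proof. exact/esym/tensor_scale_pi. Qed.

Fact tens_linearl w : linear (fun v : V => tens v w : tensor).
Proof.
move=> a v v'; rewrite tens.unlock -tensor_piZ -raddfD.
exact/tensor_piE/mem_lspan/BilinearRelL.
Qed.

Fact tens_linearr (v : V) : linear (fun w : W => tens v w : tensor).
Proof.
move=> a w w'; rewrite tens.unlock -tensor_piZ -raddfD.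
exact/tensor_piE/mem_lspan/BilinearRelR.
Qed.

HB.instance Definition _ :=
  bilinear_isBilinear.Build F V W tensor _ _ (@tens F V W)
    (tens_linearl, tens_linearr).

End TensorLmodule.

Section TensorLift.
Variables (F : fieldType) (V W U : lmodType F).

Section FreeModuleLift.
Variables (K : choiceType) (f : K -> U).

HB.instance Definition _ := GRing.isZmodMorphism.Build {freeg K / F} U
  (fglift f) (lift_is_additive f).

Lemma fgliftZ a D : fglift f (a *: D) = a *: fglift f D.
Proof.
rewrite -[in RHS](freeg_sumE D) !raddf_sum.
by apply: eq_bigr => x _ /=; rewrite !liftU scalerA.
Qed.

End FreeModuleLift.

Variable f : {bilinear V -> W -> U}.

Definition tens_lift (t : tensor V W) : U :=
  fglift (fun p => f p.1 p.2) (repr t).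

Let tens_lift_pi x :
  tens_lift (\pi_(tensor V W) x) = fglift (fun p => f p.1 p.2) x.
Proof.
have fK : {subset lspan (@bilinear_relation _ V W) <=
    [pred D | fglift (fun p => f p.1 p.2) D == 0]}.
  apply: lspan_min => [|D]; first split=> [|a D D'].
  - by rewrite inE raddf0.
  - by rewrite !inE raddfD /= fgliftZ => /eqP-> /eqP->; rewrite scaler0 addr0.
  - by case=> *; rewrite inE raddfB raddfD /= fgliftZ !liftU !scale1r /=
      ?linearPl ?linearPr subrr.
apply/eqP; rewrite -subr_eq0 -raddfB; apply: fK.
by apply/tensor_piE; rewrite reprK.
Qed.

Lemma tens_liftE v w : tens_lift (tens v w) = f v w.
Proof. by rewrite tens.unlock tens_lift_pi liftU scale1r. Qed.

Fact tens_lift_is_linear : linear tens_lift.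
Proof.
move=> a; elim/quotW=> x; elim/quotW=> y.
by rewrite -tensor_piZ -raddfD !tens_lift_pi raddfD /= fgliftZ.
Qed.

HB.instance Definition _ := GRing.isLinear.Build F (tensor V W) U _
  tens_lift tens_lift_is_linear.

Lemma tensor_ind (P : {pred tensor V W}) : submod_closed P ->
  (forall v w, tens v w \in P) -> forall t, t \in P.
Proof.
move=> [P0 Pl] Pt; elim/quotW=> D; rewrite -(freeg_sumE D).
rewrite raddf_sum; elim/big_rec: _ => // -[v w] t _ tP.
have -> : << coeff (v, w) D *g (v, w) >> = coeff (v, w) D *: << (v, w) >>.
  by apply/eqP/freeg_eqP => k; rewrite coeffZ !coeffU mul1r.
by rewrite /= tensor_piZ; apply: Pl => //; move: (Pt v w); rewrite tens.unlock.
Qed.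

Lemma tens_ext (g h : {linear tensor V W -> U}) :
  (forall v w, g (tens v w) = h (tens v w)) -> g =1 h.
Proof.
move=> gh t; apply/eqP; rewrite -[_ == _]/(t \in [pred t | g t == h t]).
apply: tensor_ind => [|v w]; last by rewrite inE gh.
split=> [|a x y]; first by rewrite inE !linear0.
by rewrite !inE !linearP => /eqP-> /eqP->.
Qed.

End TensorLift.

(* Parities are booleans (true = odd), added with (+); the Koszul sign of a
   pair of parities is (-1) ^+ (p && q). *)
HB.mixin Record Lmodule_isSuper (F : fieldType) V of GRing.Lmodule F V := {
  homog : bool -> {pred V};
  homog_submod_closed : forall p, submod_closed (homog p);
  homog_decomp : forall v : V, exists v0 v1 : V,
    [/\ v0 \in homog false, v1 \in homog true & v = v0 + v1];
  homog_disjoint : forall v : V,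
    v \in homog false -> v \in homog true -> v = 0
}.

#[short(type="superType")]
HB.structure Definition Super (F : fieldType) :=
  {V of GRing.Lmodule F V & Lmodule_isSuper F V}.

Section HomogeneousComponents.
Variables (F : fieldType) (V : superType F).
Implicit Types (p q : bool) (u v : V).

HB.instance Definition _ p := GRing.isSubmodClosed.Build F V (homog p)
  (GRing.submod_closed_semi (homog_submod_closed p)).

Fact hcomp_exists p v :
  exists u, u \in homog p /\ v - u \in homog (~~ p).
Proof.
have [v0 [v1 [h0 h1 ->]]] := homog_decomp v.
by case: p; [exists v1; rewrite addrK | exists v0; rewrite addrC addKr].
Qed.

Definition hcomp p v : V := sval (cid (hcomp_exists p v)).

Lemma hcomp_homog p v : hcomp p v \in homog p.
Proof. by rewrite /hcomp; case: cid => u []. Qed.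

Lemma homog_eq0 p v : v \in homog p -> v \in homog (~~ p) -> v = 0.
Proof. by case: p => /= h h'; apply: homog_disjoint. Qed.

Lemma hcomp_eq p u v : u \in homog p -> v - u \in homog (~~ p) ->
  hcomp p v = u.
Proof.
move=> up vup; rewrite /hcomp; case: cid => w /= [wp vwp].
apply/eqP; rewrite -subr_eq0; apply/eqP.
apply: (@homog_eq0 p); first by rewrite rpredB.
have -> : w - u = (v - u) - (v - w) by rewrite opprB [RHS]addrC addrA subrK.
by rewrite rpredB.
Qed.

Fact hcomp_is_linear p : linear (hcomp p).
Proof.
move=> a u v; have hE w : w - hcomp p w \in homog (~~ p).
  by rewrite /hcomp; case: cid => x [].
apply: hcomp_eq; first by rewrite rpredD ?rpredZ ?hcomp_homog.
by rewrite opprD addrACA -scalerBr rpredD ?rpredZ.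
Qed.

HB.instance Definition _ p :=
  GRing.isLinear.Build F V V _ (hcomp p) (hcomp_is_linear p).

Lemma hcomp_id p q v : v \in homog p -> hcomp q v = if p == q then v else 0.
Proof.
move=> vp; have [<-|pq] := eqVneq p q.
  by apply: hcomp_eq => //; rewrite subrr rpred0.
apply: hcomp_eq; first exact: rpred0.
by rewrite subr0; move: p q vp pq => [] [].
Qed.

Lemma hcompD v : v = hcomp false v + hcomp true v.
Proof.
have [v0 [v1 [h0 h1 ->]]] := homog_decomp v.
by rewrite !linearD /= !(hcomp_id _ h0) !(hcomp_id _ h1) addr0 add0r.
Qed.

End HomogeneousComponents.

Definition homog_map (F : fieldType) (V W : superType F) (p : bool)
    (f : V -> W) : Prop :=
  forall q v, v \in homog q -> f v \in homog (p (+) q).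

Definition even_map (F : fieldType) (V W : superType F) (f : V -> W) : Prop :=
  homog_map false f.

(* The ground field is purely even. *)
Section GroundField.
Variable F : fieldType.

Definition ground_homog (p : bool) : {pred F^o} :=
  if p then pred1 0 else predT.

Fact ground_homog_submod_closed p : submod_closed (ground_homog p).
Proof.
case: p => //; split=> [|a u v]; first by rewrite inE.
by rewrite !inE => /eqP-> /eqP->; rewrite scaler0 addr0.
Qed.

Fact ground_homog_decomp (v : F^o) : exists v0 v1 : F^o,
  [/\ v0 \in ground_homog false, v1 \in ground_homog true & v = v0 + v1].
Proof. by exists v, 0; split; rewrite ?addr0 //; apply: eqxx. Qed.

Fact ground_homog_disjoint (v : F^o) :
  v \in ground_homog false -> v \in ground_homog true -> v = 0.
Proof. by move=> _ /eqP. Qed.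

HB.instance Definition _ := Lmodule_isSuper.Build F F^o
  ground_homog_submod_closed ground_homog_decomp ground_homog_disjoint.

End GroundField.

(* A linear map g is the sum of hdeg false g and hdeg true g, its homogeneous
   components for the grading of Hom(V, W). *)
Section HomogeneousMaps.
Variables (F : fieldType) (V W : superType F) (g : {linear V -> W}).

Definition hdeg (p : bool) (v : V) : W :=
  \sum_(q : bool) hcomp (p (+) q) (g (hcomp q v)).

Fact hdeg_is_linear p : linear (hdeg p).
Proof.
move=> a u v; rewrite scaler_sumr -big_split /=.
by apply: eq_bigr => q _; rewrite !linearP.
Qed.

HB.instance Definition _ p :=
  GRing.isLinear.Build F V W _ (hdeg p) (hdeg_is_linear p).

Lemma hdeg_homog p : homog_map p (hdeg p).
Proof.
move=> q v vq; rewrite /hdeg big_bool /= !(hcomp_id _ vq).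
by case: q vq => vq /=; rewrite !linear0 ?addr0 ?add0r hcomp_homog.
Qed.

Lemma hdegD v : g v = hdeg false v + hdeg true v.
Proof.
rewrite /hdeg !big_bool /= addrACA [X in X + _]addrC -!hcompD.
by rewrite addrC -linearD -hcompD.
Qed.

Lemma hdeg_id p q v :
  homog_map p g -> hdeg q v = if p == q then g v else 0.
Proof.
move=> gp; rewrite [in RHS](hcompD v) linearD /hdeg big_bool /=.
have hg r := gp _ _ (hcomp_homog r v).
rewrite !(hcomp_id _ (hg _)).
by case: p q {gp hg} => [] [] /=; rewrite ?addr0 // addrC.
Qed.

End HomogeneousMaps.

Section SuperTensorMap.
Variables (F : fieldType) (V V' W W' : superType F).
Variables (f : {linear V -> V'}) (g : {linear W -> W'}).

Definition stens_map_def (v : V) (w : W) : tensor V' W' :=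
  \sum_(p : bool) \sum_(q : bool)
    (-1) ^+ (p && q) *: tens (f (hcomp q v)) (hdeg g p w).

Fact stens_map_def_is_bilinear :
  bilinear_for (GRing.Scale.Law.clone _ _ *:%R _)
    (GRing.Scale.Law.clone _ _ *:%R _) stens_map_def.
Proof.
by split=> [w a v v'|v a w w']; rewrite /= scaler_sumr -big_split /=;
  apply: eq_bigr => p _; rewrite scaler_sumr -big_split /=;
  apply: eq_bigr => q _;
  rewrite !linearP ?linearPl ?linearPr scalerDr !scalerA mulrC.
Qed.

HB.instance Definition _ := bilinear_isBilinear.Build F V W (tensor V' W') _ _
  stens_map_def stens_map_def_is_bilinear.

(* The super tensor product f (x) g; stens_mapE is the sign rule. *)
Definition stens_map : tensor V W -> tensor V' W' := tens_lift stens_map_def.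

HB.instance Definition _ := GRing.Linear.on stens_map.

Lemma stens_mapE p q v w : homog_map p g -> v \in homog q ->
  stens_map (tens v w) = (-1) ^+ (p && q) *: tens (f v) (g w).
Proof.
move=> gp vq; rewrite /stens_map tens_liftE /= /stens_map_def !big_bool /=.
rewrite !(hcomp_id _ vq) !(hdeg_id _ _ gp).
by case: p q {gp vq} => [] [] /=;
  rewrite ?linear0 ?linear0r ?linear0l ?scaler0 ?addr0 ?add0r.
Qed.

End SuperTensorMap.

Arguments stens_mapE {F V V' W W' f g p q v} w _ _.

Section TensorGrading.
Variables (F : fieldType) (V W : superType F).

Definition tensor_homog (p : bool) : {pred tensor V W} :=
  lspan (fun t => exists q v w,
    [/\ v \in homog q, w \in homog (p (+) q) & t = tens v w]).

Definition tens_hcomp p (v : V) (w : W) : tensor V W :=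
  \sum_(q : bool) tens (hcomp q v) (hcomp (p (+) q) w).

Fact tens_hcomp_is_bilinear p :
  bilinear_for (GRing.Scale.Law.clone _ _ *:%R _)
    (GRing.Scale.Law.clone _ _ *:%R _) (tens_hcomp p).
Proof.
by split=> [w a v v'|v a w w']; rewrite /= scaler_sumr -big_split /=;
  apply: eq_bigr => q _; rewrite !linearP ?linearPl ?linearPr.
Qed.

HB.instance Definition _ p := bilinear_isBilinear.Build F V W (tensor V W) _ _
  (tens_hcomp p) (tens_hcomp_is_bilinear p).

Let thcomp_homog p t : tens_lift (tens_hcomp p) t \in tensor_homog p.
Proof.
apply: (@tensor_ind _ _ _ [pred t | tens_lift (tens_hcomp p) t
  \in tensor_homog p]) => [|v w].
  split=> [|a x y]; first by rewrite inE linear0 rpred0.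
  by rewrite !inE linearP => hx hy; rewrite rpredD ?rpredZ.
rewrite inE tens_liftE /= rpred_sum // => q _.
by apply: mem_lspan; exists q, (hcomp q v), (hcomp (p (+) q) w);
  rewrite !hcomp_homog.
Qed.

Let thcompD t :
  t = tens_lift (tens_hcomp false) t + tens_lift (tens_hcomp true) t.
Proof.
apply/eqP; apply: (@tensor_ind _ _ _ [pred t | t ==
  tens_lift (tens_hcomp false) t + tens_lift (tens_hcomp true) t]) => [|v w].
  split=> [|a x y]; first by rewrite inE !linear0 addr0.
  rewrite !inE => /eqP hx /eqP hy; rewrite {1}hx {1}hy !linearP scalerDr.
  by rewrite addrACA.
rewrite inE !tens_liftE /= /tens_hcomp !big_bool /=.
rewrite {1}(hcompD v) {1}(hcompD w) linearDl !linearDr /=.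
by rewrite [X in _ == X + _]addrC [X in _ == _ + X]addrC [X in _ == X]addrACA
  [X in _ == _ + X]addrC.
Qed.

Let thcomp_id p q t : t \in tensor_homog p ->
  tens_lift (tens_hcomp q) t = if p == q then t else 0.
Proof.
move=> tp; apply/eqP; apply: (lspan_min (W := [pred t |
  tens_lift (tens_hcomp q) t == if p == q then t else 0]) _ _ tp).
  split=> [|a x y]; first by rewrite inE linear0 if_same.
  rewrite !inE => /eqP hx /eqP hy; rewrite linearP /= hx hy.
  by case: (p == q); rewrite ?scaler0 ?addr0.
move=> _ [r [v [w [vr wr ->]]]]; rewrite inE tens_liftE /= /tens_hcomp.
rewrite big_bool /= !(hcomp_id _ vr) !(hcomp_id _ wr).
by apply/eqP; case: p q r {tp vr wr} => [] [] [] /=;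
  rewrite ?linear0 ?linear0l ?linear0r ?addr0 ?add0r.
Qed.

Fact tensor_homog_submod_closed p : submod_closed (tensor_homog p).
Proof. exact: lspan_submod_closed. Qed.

Fact tensor_homog_decomp (t : tensor V W) : exists t0 t1 : tensor V W,
  [/\ t0 \in tensor_homog false, t1 \in tensor_homog true & t = t0 + t1].
Proof.
exists (tens_lift (tens_hcomp false) t), (tens_lift (tens_hcomp true) t).
by split; [exact: thcomp_homog | exact: thcomp_homog | exact: thcompD].
Qed.

Fact tensor_homog_disjoint (t : tensor V W) :
  t \in tensor_homog false -> t \in tensor_homog true -> t = 0.
Proof.
by move=> h0 h1; have := thcomp_id false h0; rewrite (thcomp_id false h1).
Qed.

HB.instance Definition _ := Lmodule_isSuper.Build F (tensor V W)
  tensor_homog_submod_closed tensor_homog_decomp tensor_homog_disjoint.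

End TensorGrading.

Section Associator.
Variables (F : fieldType) (U V W : lmodType F).

Definition tens_assoc_inner (w : W) (u : U) (v : V) :
  tensor U (tensor V W) := tens u (tens v w).

Fact tens_assoc_inner_is_bilinear w :
  bilinear_for (GRing.Scale.Law.clone _ _ *:%R _)
    (GRing.Scale.Law.clone _ _ *:%R _) (tens_assoc_inner w).
Proof.
by split=> [v a u u'|u a v v']; rewrite /= /tens_assoc_inner;
  rewrite ?linearPl // linearPr.
Qed.

HB.instance Definition _ w := bilinear_isBilinear.Build F U V
  (tensor U (tensor V W)) _ _ (tens_assoc_inner w)
  (tens_assoc_inner_is_bilinear w).

Definition tens_assoc_outer (t : tensor U V) (w : W) :
  tensor U (tensor V W) := tens_lift (tens_assoc_inner w) t.

Fact tens_assoc_outer_is_bilinear :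
  bilinear_for (GRing.Scale.Law.clone _ _ *:%R _)
    (GRing.Scale.Law.clone _ _ *:%R _) tens_assoc_outer.
Proof.
split=> [w a t t'|t a w w']; rewrite /= /tens_assoc_outer ?linearP //.
apply/eqP; apply: (@tensor_ind _ _ _ [pred t |
  tens_lift (tens_assoc_inner (a *: w + w')) t ==
  a *: tens_lift (tens_assoc_inner w) t + tens_lift (tens_assoc_inner w') t])
  => [|u v].
  split=> [|b x y]; first by rewrite inE !linear0 ?scaler0 addr0.
  rewrite !inE => /eqP hx /eqP hy; rewrite !linearP /= hx hy !scalerDr !scalerA.
  by rewrite mulrC addrACA.
by rewrite inE !tens_liftE /= /tens_assoc_inner !linearPr.
Qed.

HB.instance Definition _ := bilinear_isBilinear.Build F (tensor U V) W
  (tensor U (tensor V W)) _ _ tens_assoc_outer tens_assoc_outer_is_bilinear.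

Definition tens_assoc : tensor (tensor U V) W -> tensor U (tensor V W) :=
  tens_lift tens_assoc_outer.

HB.instance Definition _ := GRing.Linear.on tens_assoc.

Lemma tens_assocE u v w :
  tens_assoc (tens (tens u v) w) = tens u (tens v w).
Proof. by rewrite /tens_assoc !tens_liftE /= /tens_assoc_outer tens_liftE. Qed.

End Associator.

HB.mixin Record Super_isSuperAlgebra (F : fieldType) A
    of GRing.Algebra F A & Super F A := {
  homog1 : (1 : A) \in homog false;
  homogM : forall (p q : bool) (a b : A),
    a \in homog p -> b \in homog q -> a * b \in homog (p (+) q)
}.

#[short(type="superAlgType")]
HB.structure Definition SuperAlgebra (F : fieldType) :=
  {A of GRing.Algebra F A & Super F A & Super_isSuperAlgebra F A}.

Section AlgebraMultiplication.
Variables (F : fieldType) (A : algType F).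

Definition amul (a b : A) : A := a * b.

Fact amul_is_bilinear :
  bilinear_for (GRing.Scale.Law.clone _ _ *:%R _)
    (GRing.Scale.Law.clone _ _ *:%R _) amul.
Proof.
split=> [b c a a'|a c b b']; rewrite /= /amul.
  by rewrite mulrDl scalerAl.
by rewrite mulrDr scalerAr.
Qed.

HB.instance Definition _ := bilinear_isBilinear.Build F A A A _ _
  amul amul_is_bilinear.

Definition tens_mul : tensor A A -> A := tens_lift amul.

HB.instance Definition _ := GRing.Linear.on tens_mul.

Lemma tens_mulE a b : tens_mul (tens a b) = a * b.
Proof. by rewrite /tens_mul tens_liftE. Qed.

End AlgebraMultiplication.

Section SuperTensorProductMultiplication.
Variables (F : fieldType) (A B : superAlgType F).

Definition stens_mul_def (a : A) (b : B) (c : A) (d : B) : tensor A B :=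
  \sum_(p : bool) \sum_(q : bool)
    (-1) ^+ (p && q) *: tens (a * hcomp q c) (hcomp p b * d).

Fact stens_mul_def_is_bilinear a b :
  bilinear_for (GRing.Scale.Law.clone _ _ *:%R _)
    (GRing.Scale.Law.clone _ _ *:%R _) (stens_mul_def a b).
Proof.
by split=> [d k c c'|c k d d']; rewrite /= scaler_sumr -big_split /=;
  apply: eq_bigr => p _; rewrite scaler_sumr -big_split /=;
  apply: eq_bigr => q _;
  rewrite ?linearP mulrDr -scalerAr ?linearPl ?linearPr scalerDr !scalerA mulrC.
Qed.

HB.instance Definition _ a b := bilinear_isBilinear.Build F A B (tensor A B)
  _ _ (stens_mul_def a b) (stens_mul_def_is_bilinear a b).

Definition stens_mul_left (u : tensor A B) (a : A) (b : B) : tensor A B :=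
  tens_lift (stens_mul_def a b) u.

Fact stens_mul_left_is_bilinear u :
  bilinear_for (GRing.Scale.Law.clone _ _ *:%R _)
    (GRing.Scale.Law.clone _ _ *:%R _) (stens_mul_left u).
Proof.
split=> [b k a a'|a k b b']; rewrite /= /stens_mul_left; apply/eqP.
  apply: (@tensor_ind _ _ _ [pred u |
    tens_lift (stens_mul_def (k *: a + a') b) u ==
    k *: tens_lift (stens_mul_def a b) u + tens_lift (stens_mul_def a' b) u])
    => [|c d].
    split=> [|l x y]; first by rewrite inE !linear0 ?scaler0 addr0.
    rewrite !inE => /eqP hx /eqP hy; rewrite !linearP /= hx hy !scalerDr !scalerA.
    by rewrite mulrC addrACA.
  rewrite inE !tens_liftE /= /stens_mul_def; apply/eqP.
  rewrite scaler_sumr -big_split /=; apply: eq_bigr => p _.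
  rewrite scaler_sumr -big_split /=; apply: eq_bigr => q _.
  by rewrite mulrDl -scalerAl linearPl scalerDr !scalerA mulrC.
apply: (@tensor_ind _ _ _ [pred u |
  tens_lift (stens_mul_def a (k *: b + b')) u ==
  k *: tens_lift (stens_mul_def a b) u + tens_lift (stens_mul_def a b') u])
  => [|c d].
  split=> [|l x y]; first by rewrite inE !linear0 ?scaler0 addr0.
  rewrite !inE => /eqP hx /eqP hy; rewrite !linearP /= hx hy !scalerDr !scalerA.
  by rewrite mulrC addrACA.
rewrite inE !tens_liftE /= /stens_mul_def; apply/eqP.
rewrite scaler_sumr -big_split /=; apply: eq_bigr => p _.
rewrite scaler_sumr -big_split /=; apply: eq_bigr => q _.
by rewrite linearP mulrDl -scalerAl linearPr scalerDr !scalerA mulrC.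
Qed.

HB.instance Definition _ u := bilinear_isBilinear.Build F A B (tensor A B)
  _ _ (stens_mul_left u) (stens_mul_left_is_bilinear u).

(* The product of the superalgebra A (x) B; stens_mulE is its sign rule. *)
Definition stens_mul (t u : tensor A B) : tensor A B :=
  tens_lift (stens_mul_left u) t.

Lemma stens_mulE p q a b c d : b \in homog p -> c \in homog q ->
  stens_mul (tens a b) (tens c d)
  = (-1) ^+ (p && q) *: tens (a * c) (b * d).
Proof.
move=> bp cq; rewrite /stens_mul tens_liftE /= /stens_mul_left tens_liftE /=.
rewrite /stens_mul_def !big_bool /= !(hcomp_id _ bp) !(hcomp_id _ cq).
by case: p q {bp cq} => [] [] /=; rewrite ?(mul0r, mulr0, linear0, linear0l,
  linear0r, scaler0, addr0, add0r).
Qed.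

Fact stens_mul_is_bilinear :
  bilinear_for (GRing.Scale.Law.clone _ _ *:%R _)
    (GRing.Scale.Law.clone _ _ *:%R _) stens_mul.
Proof.
split=> [u k t t'|t k u u']; rewrite /= /stens_mul ?linearP //.
apply/eqP; apply: (@tensor_ind _ _ _ [pred t |
  tens_lift (stens_mul_left (k *: u + u')) t ==
  k *: tens_lift (stens_mul_left u) t + tens_lift (stens_mul_left u') t])
  => [|a b].
  split=> [|l x y]; first by rewrite inE !linear0 ?scaler0 addr0.
  rewrite !inE => /eqP hx /eqP hy; rewrite !linearP /= hx hy !scalerDr !scalerA.
  by rewrite mulrC addrACA.
by rewrite inE !tens_liftE /= /stens_mul_left linearP.
Qed.

HB.instance Definition _ := bilinear_isBilinear.Build F (tensor A B)
  (tensor A B) (tensor A B) _ _ stens_mul stens_mul_is_bilinear.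

End SuperTensorProductMultiplication.

(* The canonical isomorphisms A (x) F = A = F (x) A are used in the form
   a (x) 1 = a = 1 (x) a. *)
HB.mixin Record SuperAlgebra_isHopf (F : fieldType) A of SuperAlgebra F A := {
  comul : {linear A -> tensor A A};
  counit : {linear A -> F^o};
  antipode : {linear A -> A};
  comul_even : even_map comul;
  counit_even : even_map counit;
  antipode_even : even_map antipode;
  comulA : forall a : A,
    tens_assoc (stens_map comul idfun (comul a))
    = stens_map idfun comul (comul a);
  counitl : forall a : A, stens_map counit idfun (comul a) = tens 1 a;
  counitr : forall a : A, stens_map idfun counit (comul a) = tens a 1;
  comul1 : comul 1 = tens 1 1;
  comulM : forall a b : A, comul (a * b) = stens_mul (comul a) (comul b);
  counit1 : counit 1 = 1;
  counitM : forall a b : A, counit (a * b) = counit a * counit b;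
  antipodel : forall a : A,
    tens_mul (stens_map antipode idfun (comul a)) = (counit a : F) *: 1;
  antipoder : forall a : A,
    tens_mul (stens_map idfun antipode (comul a)) = (counit a : F) *: 1
}.

#[short(type="hopfSuperAlgType")]
HB.structure Definition HopfSuperAlgebra (F : fieldType) :=
  {A of SuperAlgebra F A & SuperAlgebra_isHopf F A}.

(* I ranges over the full dual of A and need not be homogeneous. *)
Definition left_integral (F : fieldType) (A : hopfSuperAlgType F)
    (I : {linear A -> F^o}) : Prop :=
  forall a : A, stens_map idfun I (comul a) = tens 1 (I a).

Record rcomodule (F : fieldType) (A : hopfSuperAlgType F) := RComodule {
  rcomodule_sort :> superType F;
  coact : {linear rcomodule_sort -> tensor rcomodule_sort A};
  coact_even : even_map coact;
  coactA : forall v,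
    tens_assoc (stens_map coact idfun (coact v))
    = stens_map idfun comul (coact v);
  coact_counit : forall v, stens_map idfun counit (coact v) = tens v 1
}.

Section CompleteReducibility.
Variables (F : fieldType) (A : hopfSuperAlgType F) (V : rcomodule A).
Implicit Types W : {pred V}.

Definition graded_subspace W : Prop :=
  submod_closed W /\
  forall w, w \in W -> exists w0 w1,
    [/\ w0 \in W /\ w0 \in homog false, w1 \in W /\ w1 \in homog true
      & w = w0 + w1].

(* The image of W (x) A in V (x) A. *)
Definition tensor_sub W : {pred tensor V A} :=
  lspan (fun t => exists2 w, w \in W & exists a, t = tens w a).

Definition subcomodule W : Prop :=
  graded_subspace W /\ forall w, w \in W -> coact V w \in tensor_sub W.

Definition complement W W' : Prop :=
  (forall v, v \in W -> v \in W' -> v = 0) /\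
  (forall v, exists w w', [/\ w \in W, w' \in W' & v = w + w']).

Definition completely_reducible : Prop :=
  forall W, subcomodule W -> exists2 W', subcomodule W' & complement W W'.

End CompleteReducibility.

(* Main.v *)
From HB Require Import structures.
Require Import Defs.
From mathcomp Require Import all_boot all_algebra reals complex.
From mathcomp Require Import boolp classical_sets.

Set Implicit Arguments.
Unset Strict Implicit.
Unset Printing Implicit Defensive.

Import GRing.Theory.
Local Open Scope ring_scope.

(** Write a_1 (x) a_2 for the coproduct of a, v_0 (x) v_1 for the coaction on v,
    S for the antipode and e for the counit.

    From an integral to complements.  The even part of a left integral I is
    again a left integral ([even_part_left_integral]): compare homogeneous
    components in the defining identity.  The odd part vanishes at 1, so I may
    be taken even with I(1) = 1, and no sign ever appears when I is evaluated.
    Given a subcomodule W of V, choose an even linear projection pi of V onto W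
    and average it:
      T(v) = w_0 I(w_1 S(v_1)),  where w = pi(v_0).
    T takes values in W; it fixes W because v_0 I(v_1 S(v_2)) = v I(1)
    ([avg_coact]); and it is a comodule map ([coact_avg_map]).  So the kernel
    of T is a complementary subcomodule.  Colinearity rests on
    I(b S(a_1)) a_2 = b_1 I(b_2 S(a)) ([integral_shift]), which is the
    integral property of I at b S(a_1) combined with
    Delta(S(a_1)) (a_2 (x) 1) = 1 (x) S(a) ([comul_antipode_times]); the latter
    is the part of the anti-comultiplicativity of S that is needed.

    From complements to an integral.  Consider A as a right comodule over
    itself.  The projection onto the subcomodule of scalars along a
    complementary subcomodule is a colinear map a |-> I(a) 1, whence
    I(a_1) a_2 = I(a) 1: this is a right integral
    ([even_right_integral_exists]).  To see that it is also a left integral,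
    put E(a) = a_1 I(a_2).  Right invariance makes E idempotent and gives
    E(a_1) (x) a_2 = E(a) (x) 1, so that ker E is a subcomodule.  Let Q be the
    projection onto a complementary subcomodule along ker E.  Then Q = Q E, so
    the coproduct of Q(a) is Q(a) (x) 1 and Q(a) is a scalar; moreover
    E(a) = E(Q(a)) = Q(a).  Hence E(a) is a scalar, necessarily I(a) 1
    ([right_integral_is_left]). *)

(** * Tensor products of linear maps *)

Section TensorMaps.
Variables (F : fieldType).

(** Induction over an additive property: a scalar can be absorbed into the first
    factor, so closure under scaling need not be checked. *)
Lemma tensor_elim (V W : lmodType F) (P : tensor V W -> Prop) :
  (forall v w, P (tens v w)) -> (forall t u, P t -> P u -> P (t + u)) ->
  forall t, P t.
Proof.
move=> Pt PD t; have t00 : tens 0 0 = 0 :> tensor V W by rewrite linear0l.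
suff: t \in [pred u | `[< forall a, P (a *: u) >]].
  by move=> /asboolP/(_ 1); rewrite scale1r.
apply: (@tensor_ind _ _ _ [pred u | `[< forall a, P (a *: u) >]]) => [|v w].
  split=> [|a x y /asboolP Px /asboolP Py].
    by apply/asboolP => a; rewrite scaler0 -t00.
  by apply/asboolP => b; rewrite scalerDr scalerA; apply: PD.
apply/asboolP => a.
have <- : tens (a *: v) w = a *: tens v w by rewrite linearZl_LR.
exact: Pt.
Qed.

Section TensLinearity.
Variables V W : lmodType F.
Implicit Types (v : V) (w : W) (c : F).

Lemma tensDl v v' w : tens (v + v') w = tens v w + tens v' w.
Proof. exact: linearDl. Qed.

Lemma tensDr v w w' : tens v (w + w') = tens v w + tens v w'.
Proof. exact: linearDr. Qed.

Lemma tensZl c v w : tens (c *: v) w = c *: tens v w.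
Proof. exact: linearZl_LR. Qed.

Lemma tensZr c v w : tens v (c *: w) = c *: tens v w.
Proof. exact: linearZr_LR. Qed.

End TensLinearity.

Lemma homog_ind (V : superType F) (P : V -> Prop) :
  (forall q v, v \in homog q -> P v) -> (forall u v, P u -> P v -> P (u + v)) ->
  forall v, P v.
Proof.
by move=> Ph PD v; rewrite (hcompD v); apply: PD; apply: Ph (hcomp_homog _ _).
Qed.

Lemma tensor_homog_elim (V W : superType F) (P : tensor V W -> Prop) :
  (forall p q v w, v \in homog p -> w \in homog q -> P (tens v w)) ->
  (forall t u, P t -> P u -> P (t + u)) -> forall t, P t.
Proof.
move=> Pt PD; apply: tensor_elim => // v w.
elim/homog_ind: v => [p v vp|v v' Pv Pv']; last by rewrite tensDl; apply: PD.
elim/homog_ind: w => [q w wq|w w' Pw Pw']; last by rewrite tensDr; apply: PD.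
exact: Pt vp wq.
Qed.

HB.instance Definition _ (V W : lmodType F) (v : V) :=
  GRing.isLinear.Build F W (tensor V W) _ (@tens F V W v)
    (@tens_linearr F V W v).

Section Tmap.
Variables (V V' W W' : lmodType F) (f : {linear V -> V'}) (g : {linear W -> W'}).

(** The tensor product of linear maps without Koszul signs.  It coincides with
    the super tensor product as soon as the second map is even
    ([stens_map_even]), which lets the computations below ignore the grading. *)
Definition tmap_def (v : V) (w : W) : tensor V' W' := tens (f v) (g w).

Fact tmap_def_is_bilinear :
  bilinear_for (GRing.Scale.Law.clone _ _ *:%R _)
    (GRing.Scale.Law.clone _ _ *:%R _) tmap_def.
Proof.
by split=> [w a v v'|v a w w']; rewrite /tmap_def /= linearP
  (tensDl, tensDr) (tensZl, tensZr).
Qed.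

HB.instance Definition _ := bilinear_isBilinear.Build F V W (tensor V' W') _ _
  tmap_def tmap_def_is_bilinear.

Definition tmap : tensor V W -> tensor V' W' := tens_lift tmap_def.

HB.instance Definition _ := GRing.Linear.on tmap.

Lemma tmapD t u : tmap (t + u) = tmap t + tmap u.
Proof. exact: linearD. Qed.

Lemma tmapP c t u : tmap (c *: t + u) = c *: tmap t + tmap u.
Proof. exact: linearP. Qed.

Lemma tmapE v w : tmap (tens v w) = tens (f v) (g w).
Proof. by rewrite /tmap tens_liftE. Qed.

End Tmap.

Lemma eq_tmap (V V' W W' : lmodType F) (f f' : {linear V -> V'})
    (g g' : {linear W -> W'}) :
  f =1 f' -> g =1 g' -> tmap f g =1 tmap f' g'.
Proof.
move=> ff' gg'; elim/tensor_elim=> [v w|t u IHt IHu].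
  by rewrite !tmapE ff' gg'.
by rewrite !tmapD IHt IHu.
Qed.

Lemma tmap_comp (V V' V'' W W' W'' : lmodType F)
    (f : {linear V' -> V''}) (f' : {linear V -> V'})
    (g : {linear W' -> W''}) (g' : {linear W -> W'}) t :
  tmap f g (tmap f' g' t) = tmap (f \o f') (g \o g') t.
Proof.
elim/tensor_elim: t => [v w|t u IHt IHu]; first by rewrite !tmapE.
by rewrite !tmapD IHt IHu.
Qed.

Lemma stens_map_even (V V' W W' : superType F) (f : {linear V -> V'})
    (g : {linear W -> W'}) : even_map g -> stens_map f g =1 tmap f g.
Proof.
move=> ge; elim/tensor_homog_elim=> [p q v w vp wq|t u IHt IHu].
  by rewrite (stens_mapE _ ge vp) scale1r tmapE.
by rewrite linearD tmapD /= IHt IHu.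
Qed.

Lemma even_id (V : superType F) : even_map (@idfun V). Proof. by []. Qed.

Section Unassoc.
Variables U V W : lmodType F.

(** The inverse of the associator, built by currying so that its existence needs
    only the universal property in each variable. *)
Definition tens_unassoc_def (u : U) : tensor V W -> tensor (tensor U V) W :=
  tmap (tens u) idfun.

Fact tens_unassoc_def_is_bilinear :
  bilinear_for (GRing.Scale.Law.clone _ _ *:%R _)
    (GRing.Scale.Law.clone _ _ *:%R _) tens_unassoc_def.
Proof.
split=> [t a u u'|u a t t']; rewrite /= /tens_unassoc_def; last exact: linearP.
elim/tensor_elim: t => [v w|t t' IHt IHt'].
  by rewrite !tmapE /= !tensDl !tensZl.
by rewrite !tmapD IHt IHt' scalerDr addrACA.
Qed.

HB.instance Definition _ := bilinear_isBilinear.Build F U (tensor V W)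
  (tensor (tensor U V) W) _ _ tens_unassoc_def tens_unassoc_def_is_bilinear.

Definition tens_unassoc : tensor U (tensor V W) -> tensor (tensor U V) W :=
  tens_lift tens_unassoc_def.

HB.instance Definition _ := GRing.Linear.on tens_unassoc.

Lemma tens_unassocD t u :
  tens_unassoc (t + u) = tens_unassoc t + tens_unassoc u.
Proof. exact: linearD. Qed.

Lemma tens_assocD (t u : tensor (tensor U V) W) :
  tens_assoc (t + u) = tens_assoc t + tens_assoc u.
Proof. exact: linearD. Qed.

Lemma tens_unassocE u v w :
  tens_unassoc (tens u (tens v w)) = tens (tens u v) w.
Proof. by rewrite /tens_unassoc tens_liftE /= /tens_unassoc_def tmapE. Qed.

Lemma tens_assocK : cancel (@tens_assoc F U V W) tens_unassoc.
Proof.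
elim/tensor_elim=> [t w|t u IHt IHu]; last first.
  by rewrite tens_assocD tens_unassocD IHt IHu.
elim/tensor_elim: t => [u v|t u IHt IHu].
  by rewrite tens_assocE tens_unassocE.
by rewrite tensDl tens_assocD tens_unassocD IHt IHu.
Qed.

End Unassoc.

Section Slices.
Variables (V A : lmodType F) (g : {linear A -> F^o}).

(** The maps id (x) g and g (x) id composed with V (x) F = V and F (x) V = V. *)
Definition slice_def (v : V) (a : A) : V := (g a : F) *: v.

Fact slice_def_is_bilinear :
  bilinear_for (GRing.Scale.Law.clone _ _ *:%R _)
    (GRing.Scale.Law.clone _ _ *:%R _) slice_def.
Proof.
split=> [a k v v'|v k a a']; rewrite /slice_def /=.
  by rewrite scalerDr !scalerA mulrC.
by rewrite linearP scalerDl scalerA.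
Qed.

HB.instance Definition _ := bilinear_isBilinear.Build F V A V _ _
  slice_def slice_def_is_bilinear.

Definition slice : tensor V A -> V := tens_lift slice_def.
HB.instance Definition _ := GRing.Linear.on slice.

Lemma sliceD t u : slice (t + u) = slice t + slice u.
Proof. exact: linearD. Qed.

Lemma sliceP c t u : slice (c *: t + u) = (c : F) *: slice t + slice u.
Proof. exact: linearP. Qed.

Lemma sliceE v a : slice (tens v a) = (g a : F) *: v.
Proof. by rewrite /slice tens_liftE. Qed.

Definition lslice_def (a : A) (v : V) : V := (g a : F) *: v.

Fact lslice_def_is_bilinear :
  bilinear_for (GRing.Scale.Law.clone _ _ *:%R _)
    (GRing.Scale.Law.clone _ _ *:%R _) lslice_def.
Proof.
split=> [v k a a'|a k v v']; rewrite /lslice_def /=.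
  by rewrite linearP scalerDl scalerA.
by rewrite scalerDr !scalerA mulrC.
Qed.

HB.instance Definition _ := bilinear_isBilinear.Build F A V V _ _
  lslice_def lslice_def_is_bilinear.

Definition lslice : tensor A V -> V := tens_lift lslice_def.
HB.instance Definition _ := GRing.Linear.on lslice.

Lemma lsliceD t u : lslice (t + u) = lslice t + lslice u.
Proof. exact: linearD. Qed.

Lemma lsliceE a v : lslice (tens a v) = (g a : F) *: v.
Proof. by rewrite /lslice tens_liftE. Qed.

End Slices.
End TensorMaps.

Definition tensD :=
  (tensDl, tensDr, tmapD, tens_assocD, tens_unassocD, sliceD, lsliceD).

(** * Evaluating linear forms on tensor factors *)

Section SliceTheory.
Variable F : fieldType.
Implicit Types V W A B : lmodType F.

Lemma eq_slice V A (g g' : {linear A -> F^o}) :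
  g =1 g' -> slice g =1 slice g' :> (tensor V A -> V).
Proof.
move=> gg'; elim/tensor_elim=> [v a|t u IHt IHu]; first by rewrite !sliceE gg'.
by rewrite !tensD /= IHt IHu.
Qed.

Lemma slice_tmap V V' A B (f : {linear V -> V'}) (h : {linear A -> B})
    (g : {linear B -> F^o}) t :
  slice g (tmap f h t) = f (slice (g \o h) t).
Proof.
elim/tensor_elim: t => [v a|t u IHt IHu].
  by rewrite tmapE !sliceE linearZ.
by rewrite !tensD linearD IHt IHu.
Qed.

Lemma lslice_tmap V V' A B (f : {linear V -> V'}) (h : {linear A -> B})
    (g : {linear B -> F^o}) t :
  lslice g (tmap h f t) = f (lslice (g \o h) t).
Proof.
elim/tensor_elim: t => [v a|t u IHt IHu].
  by rewrite tmapE /= !lsliceE linearZ.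
by rewrite !tensD linearD IHt IHu.
Qed.

Lemma linear_slice V V' A (f : {linear V -> V'}) (g : {linear A -> F^o}) t :
  f (slice g t) = slice g (tmap f idfun t).
Proof. by rewrite slice_tmap; congr (f _); apply: eq_slice. Qed.

(** This lemma and the next one move a form across the associator, which is how
    coassociativity yields identities such as a_1 I(a_2) (x) a_3 =
    a_1 (x) I(a_2) a_3. *)
Lemma slice_assoc U V A (g : {linear A -> F^o}) (t : tensor (tensor U V) A) :
  tmap idfun (slice g) (tens_assoc t) = slice g t.
Proof.
elim/tensor_elim: t => [t a|t u IHt IHu]; last by rewrite !tensD /= IHt IHu.
elim/tensor_elim: t => [u v|t u IHt IHu].
  by rewrite tens_assocE tmapE /= !sliceE tensZr.
by rewrite !tensD /= IHt IHu.
Qed.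

Lemma slice_lslice_assoc V A W (g : {linear A -> F^o})
    (t : tensor (tensor V A) W) :
  tmap (slice g) idfun t = tmap idfun (lslice g) (tens_assoc t).
Proof.
elim/tensor_elim: t => [t w|t u IHt IHu]; last by rewrite !tensD /= IHt IHu.
elim/tensor_elim: t => [v a|t u IHt IHu].
  by rewrite tens_assocE !tmapE /= sliceE lsliceE tensZl tensZr.
by rewrite !tensD /= IHt IHu.
Qed.

Lemma tmap_slice V A (g : {linear A -> F^o}) (t : tensor V A) :
  tmap idfun g t = tens (slice g t) 1.
Proof.
elim/tensor_elim: t => [v a|t u IHt IHu].
  by rewrite tmapE sliceE tensZl -tensZr [_ *: _]mulr1.
by rewrite !tensD /= IHt IHu.
Qed.

Lemma tmap_lslice V A (g : {linear A -> F^o}) (t : tensor A V) :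
  tmap g idfun t = tens 1 (lslice g t).
Proof.
elim/tensor_elim: t => [a v|t u IHt IHu].
  by rewrite tmapE lsliceE tensZr -tensZl [_ *: _]mulr1.
by rewrite !tensD /= IHt IHu.
Qed.

Lemma tens1_inj V : injective (fun v : V => tens v (1 : F^o)).
Proof.
by move=> v w /(congr1 (slice idfun)); rewrite !sliceE !scale1r.
Qed.

Lemma tens1l_inj V : injective (fun v : V => tens (1 : F^o) v).
Proof.
by move=> v w /(congr1 (lslice idfun)); rewrite !lsliceE !scale1r.
Qed.

End SliceTheory.

Section Line.
Variables (F : fieldType) (V : lmodType F) (u : V).
Definition line (c : F^o) : V := (c : F) *: u.
Fact line_is_linear : linear line.
Proof. by move=> a c d; rewrite /line scalerDl scalerA. Qed.
HB.instance Definition _ := GRing.isLinear.Build F F^o V _ line line_is_linear.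
End Line.

(** * Hopf superalgebra axioms without signs *)

Section Hopf.
Variables (F : fieldType) (A : hopfSuperAlgType F).
Implicit Types a b c d : A.

Lemma comul_assoc a :
  tens_assoc (tmap comul idfun (comul a)) = tmap idfun comul (comul a).
Proof.
by rewrite -!stens_map_even ?comulA //; exact: comul_even.
Qed.

Lemma comodule_assoc (V : rcomodule A) (v : V) :
  tens_assoc (tmap (coact V) idfun (coact V v)) = tmap idfun comul (coact V v).
Proof.
by rewrite -!stens_map_even ?coactA //; exact: comul_even.
Qed.

Lemma slice_counit_coact (V : rcomodule A) (v : V) :
  slice counit (coact V v) = v.
Proof.
apply: tens1_inj; rewrite -tmap_slice -stens_map_even ?coact_counit //.
exact: counit_even.
Qed.

Lemma slice_counit a : slice counit (comul a) = a.
Proof.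
apply: tens1_inj; rewrite -tmap_slice -stens_map_even ?counitr //.
exact: counit_even.
Qed.

Lemma lslice_counit a : lslice counit (comul a) = a.
Proof.
by apply: tens1l_inj; rewrite -tmap_lslice -stens_map_even ?counitl.
Qed.

Lemma antipoder_tmap a :
  tens_mul (tmap idfun antipode (comul a)) = line 1 (counit a).
Proof. by rewrite -stens_map_even ?antipoder //; exact: antipode_even. Qed.

Lemma antipodel_tmap a :
  tens_mul (tmap antipode idfun (comul a)) = line 1 (counit a).
Proof. by rewrite -stens_map_even ?antipodel. Qed.

Lemma stens_mulDl (s t u : tensor A A) :
  stens_mul (s + t) u = stens_mul s u + stens_mul t u.
Proof. exact: linearDl. Qed.

Lemma stens_mulDr (s t u : tensor A A) :
  stens_mul s (t + u) = stens_mul s t + stens_mul s u.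
Proof. exact: linearDr. Qed.

Lemma stens_mulZl (k : F) (t u : tensor A A) :
  stens_mul (k *: t) u = k *: stens_mul t u.
Proof. exact: linearZl_LR. Qed.

Lemma stens_mulZr (k : F) (t u : tensor A A) :
  stens_mul t (k *: u) = k *: stens_mul t u.
Proof. exact: linearZr_LR. Qed.

Lemma stens_mulA (s t u : tensor A A) :
  stens_mul s (stens_mul t u) = stens_mul (stens_mul s t) u.
Proof.
elim/tensor_homog_elim: s t u => [p1 q1 a b ap bq|s s' IHs IHs'] t u; last first.
  by rewrite !stens_mulDl IHs IHs'.
elim/tensor_homog_elim: t u => [p2 q2 c d cp dq|t t' IHt IHt'] u; last first.
  by rewrite stens_mulDl !stens_mulDr stens_mulDl IHt IHt'.
elim/tensor_homog_elim: u => [p3 q3 e f ep fq|u u' IHu IHu']; last first.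
  by rewrite !stens_mulDr IHu IHu'.
rewrite (stens_mulE _ _ dq ep) (stens_mulE _ _ bq cp) stens_mulZr stens_mulZl.
rewrite (stens_mulE _ _ bq (homogM _ _ _ _ cp ep)).
rewrite (stens_mulE _ _ (homogM _ _ _ _ bq dq) ep).
rewrite !scalerA -!signr_addb !mulrA; congr (_ ^+ _ *: _).
by case: p2 q1 p3 q2 {ap bq cp dq ep fq} => [] [] [] [].
Qed.

Lemma stens_mul_tens1r a b d : stens_mul (tens a b) (tens 1 d) = tens a (b * d).
Proof.
elim/homog_ind: b => [q b bq|b b' IHb IHb'].
  by rewrite (stens_mulE _ _ bq homog1) andbF scale1r mulr1.
by rewrite tensDr stens_mulDl IHb IHb' mulrDl tensDr.
Qed.

(** The Koszul sign in (a (x) b)(c (x) 1) is nontrivial only for odd b, and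
    there an even form vanishes. *)
Lemma slice_stens_mul_tens1 (I : {linear A -> F^o}) (t : tensor A A) c :
  even_map I ->
  slice I (stens_mul t (tens c 1)) = slice I t * c.
Proof.
move=> Ie; elim/tensor_homog_elim: t => [p q a b ap bq|t u IHt IHu]; last first.
  by rewrite stens_mulDl !sliceD IHt IHu mulrDl.
elim/homog_ind: c => [r c cr|c c' IHc IHc']; last first.
  by rewrite tensDl stens_mulDr sliceD IHc IHc' mulrDr.
rewrite (stens_mulE _ _ bq cr) linearZ /= !sliceE mulr1 -scalerAl.
case: q bq => [bq|_]; last by rewrite scale1r.
by have /eqP-> := Ie _ _ bq; rewrite !scale0r scaler0.
Qed.

End Hopf.

(** * Integrals and the antipode *)

HB.instance Definition _ (F : fieldType) (A : algType F) (b : A) :=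
  GRing.isLinear.Build F A A _ (@amul F A b)
    (@linearPr _ _ _ _ _ _ (@amul F A) b).

Section AntipodeIdentities.
Variables (F : fieldType) (A : hopfSuperAlgType F).
Implicit Types a b c d : A.

Definition stens_mul_lin : tensor (tensor A A) (tensor A A) -> tensor A A :=
  tens_lift (@stens_mul F A A).
HB.instance Definition _ := GRing.Linear.on stens_mul_lin.

Lemma stens_mul_linD s t :
  stens_mul_lin (s + t) = stens_mul_lin s + stens_mul_lin t.
Proof. exact: linearD. Qed.

Lemma stens_mul_linE s t : stens_mul_lin (tens s t) = stens_mul s t.
Proof. exact: tens_liftE. Qed.

(** In Sweedler notation x (x) y |-> Delta(x) (1 (x) S(y)). *)
Definition comul_times_antipode : tensor A A -> tensor A A :=
  stens_mul_lin \o tmap comul (tens (1 : A) \o antipode).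
HB.instance Definition _ := GRing.Linear.on comul_times_antipode.

Lemma comul_times_antipodeD s t :
  comul_times_antipode (s + t) = comul_times_antipode s + comul_times_antipode t.
Proof. exact: linearD. Qed.

(** In Sweedler notation Delta(a_1) (1 (x) S(a_2)) = a_1 (x) a_2 S(a_3), and
    a_2 S(a_3) contracts to the counit. *)
Lemma comul_times_antipodeE a : comul_times_antipode (comul a) = tens a 1.
Proof.
have E t : comul_times_antipode t
    = tmap idfun (@tens_mul F A \o tmap idfun antipode)
        (tens_assoc (tmap comul idfun t)).
  elim/tensor_elim: t => [x y|t u IHt IHu]; last first.
    by rewrite !(tensD, comul_times_antipodeD) IHt IHu.
  rewrite /comul_times_antipode /= !tmapE /= stens_mul_linE.
  elim/tensor_elim: (comul x) => [b c|t u IHt IHu].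
    by rewrite stens_mul_tens1r tens_assocE tmapE /= tmapE /= tens_mulE.
  by rewrite stens_mulDl !tensD IHt IHu.
rewrite E comul_assoc tmap_comp.
rewrite (eq_tmap (f' := idfun) (g' := line 1 \o counit)) //; last first.
  by move=> x /=; rewrite antipoder_tmap.
rewrite -[in RHS](slice_counit a).
elim/tensor_elim: (comul a) => [x y|t u IHt IHu].
  by rewrite tmapE sliceE /= tensZl linearZ.
by rewrite !tensD IHt IHu.
Qed.

(** This is Delta(S(a_1)) (a_2 (x) 1) = 1 (x) S(a).  Replace a_2 (x) 1 by
    Delta(a_2) (1 (x) S(a_3)); since Delta is multiplicative the first two
    factors combine into Delta(S(a_1) a_2), which contracts to the counit. *)
Lemma comul_antipode_times a :
  stens_mul_lin (tmap (comul \o antipode) (applyr (@tens F A A) 1) (comul a))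
  = tens 1 (antipode a).
Proof.
have E t : stens_mul_lin
      (tmap (comul \o antipode) comul_times_antipode (tens_assoc t))
    = stens_mul_lin (tmap (comul \o @tens_mul F A \o tmap antipode idfun)
        (tens (1 : A) \o antipode) t).
  elim/tensor_elim: t => [t z|t u IHt IHu]; last first.
    by rewrite !(tensD, stens_mul_linD) IHt IHu.
  elim/tensor_elim: t => [x y|t u IHt IHu]; last first.
    by rewrite !(tensD, stens_mul_linD) IHt IHu.
  rewrite tens_assocE !tmapE /= tmapE !stens_mul_linE.
  rewrite /comul_times_antipode /= tmapE stens_mul_linE /=.
  by rewrite stens_mulA -comulM tens_mulE.
transitivity (stens_mul_lin (tmap (comul \o antipode)
    (comul_times_antipode \o comul) (comul a))).
  congr (stens_mul_lin _); apply: eq_tmap => // x.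
  by rewrite /= -comul_times_antipodeE.
have -> : tmap (comul \o antipode) (comul_times_antipode \o comul) (comul a) =
   tmap (comul \o antipode) comul_times_antipode (tmap idfun comul (comul a)).
  by rewrite tmap_comp; apply: eq_tmap.
rewrite -comul_assoc E tmap_comp -[in RHS](lslice_counit a).
rewrite (eq_tmap (f' := comul \o line 1 \o counit)
   (g' := tens (1 : A) \o antipode)) //; last first.
  by move=> x /=; rewrite antipodel_tmap.
elim/tensor_elim: (comul a) => [x y|t u IHt IHu]; last first.
  by rewrite !(tensD, stens_mul_linD) [antipode _]linearD tensDr IHt IHu.
rewrite tmapE lsliceE /= stens_mul_linE /line linearZ /= comul1 stens_mulZl.
by rewrite stens_mul_tens1r mul1r linearZ tensZr.
Qed.

(** For an even form the super map id (x) I carries no sign, so the integral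
    property takes this form with values in A instead of A (x) F. *)
Definition even_left_integral (I : {linear A -> F^o}) : Prop :=
  even_map I /\ forall a, slice I (comul a) = (I a : F) *: 1.

(** In Sweedler notation I(b S(a_1)) a_2 = b_1 I(b_2 S(a)): by the integral
    property the left side is (id (x) I)(Delta(b S(a_1))) a_2, that is
    (id (x) I)(Delta(b) Delta(S(a_1)) (a_2 (x) 1)), to which
    [comul_antipode_times] applies. *)
Lemma integral_shift (I : {linear A -> F^o}) a b : even_left_integral I ->
  lslice (I \o amul b \o antipode) (comul a)
  = slice (I \o applyr (@amul F A) (antipode a)) (comul b).
Proof.
move=> [Ie II].
have E t : lslice (I \o amul b \o antipode) t = slice I (stens_mul (comul b)
    (stens_mul_lin (tmap (comul \o antipode) (applyr (@tens F A A) 1) t))).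
  elim/tensor_elim: t => [x y|t u IHt IHu]; last first.
    by rewrite !(tensD, stens_mul_linD) stens_mulDr sliceD IHt IHu.
  rewrite lsliceE tmapE /= stens_mul_linE stens_mulA -comulM.
  by rewrite slice_stens_mul_tens1 // II -scalerAl mul1r.
rewrite E comul_antipode_times.
elim/tensor_elim: (comul b) => [x y|t u IHt IHu].
  by rewrite stens_mul_tens1r !sliceE.
by rewrite stens_mulDl !tensD IHt IHu.
Qed.

End AntipodeIdentities.

(** * Averaging a linear map over an integral *)

Section Averaging.
Variables (F : fieldType) (A : hopfSuperAlgType F) (V : rcomodule A).
Variable I : {linear A -> F^o}.
Hypothesis I_int : even_left_integral I.

Definition contract : tensor (tensor V A) A -> V :=
  slice (I \o @tens_mul F A \o tmap idfun antipode) \o @tens_assoc F V A A.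
HB.instance Definition _ := GRing.Linear.on contract.

Lemma contractD s t : contract (s + t) = contract s + contract t.
Proof. exact: linearD. Qed.

Lemma contractE t a :
  contract (tens t a) = slice (I \o applyr (@amul F A) (antipode a)) t.
Proof.
elim/tensor_elim: t => [v b|t u IHt IHu].
  by rewrite /contract /= tens_assocE !sliceE /= tmapE tens_mulE.
by rewrite !(tensD, contractD) IHt IHu.
Qed.

(** In Sweedler notation v (x) a |-> v_0 I(v_1 S(a)), the averaging operator
    before a map from V to V is inserted in the first factor. *)
Definition avg : tensor V A -> V := contract \o tmap (coact V) idfun.
HB.instance Definition _ := GRing.Linear.on avg.

Lemma avgD s t : avg (s + t) = avg s + avg t.
Proof. exact: linearD. Qed.

Lemma avgE v a :
  avg (tens v a) = slice (I \o applyr (@amul F A) (antipode a)) (coact V v).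
Proof. by rewrite /avg /= tmapE -contractE. Qed.

(** In Sweedler notation the coaction sends v_0 I(v_1 S(a)) to
    v_0 (x) v_1 I(v_2 S(a)), which is v_0 I(v_1 S(a_1)) (x) a_2 by
    [integral_shift]. *)
Lemma coact_avg t :
  coact V (avg t) = tmap avg idfun (tens_unassoc (tmap idfun comul t)).
Proof.
elim/tensor_elim: t => [v a|t u IHt IHu]; last first.
  by rewrite !(tensD, avgD) [coact V _]linearD IHt IHu.
have E (u : tensor V A) :
    tmap idfun (slice (I \o applyr (@amul F A) (antipode a)) \o comul) u
    = tmap contract idfun (tens_unassoc (tens u (comul a))).
  elim/tensor_elim: u => [w b|t u IHt IHu]; last first.
    by rewrite !tensD /= IHt IHu.
  rewrite tmapE /= -integral_shift //.
  elim/tensor_elim: (comul a) => [x y|t u IHt IHu]; last first.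
    by rewrite !tensD IHt IHu.
  rewrite tens_unassocE tmapE /= contractE lsliceE sliceE /=.
  by rewrite tensZl -tensZr.
have cE x : avg (tens v x) = contract (tens (coact V v) x).
  by rewrite contractE avgE.
rewrite avgE linear_slice -slice_assoc comodule_assoc tmap_comp.
rewrite (eq_tmap (f' := idfun)
  (g' := slice (I \o applyr (@amul F A) (antipode a)) \o comul)) // E.
rewrite tmapE; elim/tensor_elim: (comul a) => [x y|t u IHt IHu].
  by rewrite !tens_unassocE !tmapE /= -cE.
by rewrite !tensD IHt IHu.
Qed.

(** Here v_0 I(v_1 S(v_2)) = v_0 e(v_1) I(1), by the antipode axiom. *)
Lemma avg_coact v : avg (coact V v) = (I 1 : F) *: v.
Proof.
rewrite /avg /contract /= comodule_assoc slice_tmap /=.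
rewrite -[in RHS](slice_counit_coact v).
elim/tensor_elim: (coact V v) => [w a|t u IHt IHu]; last first.
  by rewrite !tensD scalerDr /= IHt IHu.
by rewrite !sliceE /= antipoder_tmap /line linearZ /= scalerA mulrC.
Qed.

Variable pi : {linear V -> V}.

Definition avg_map : V -> V := avg \o tmap pi idfun \o coact V.
HB.instance Definition _ := GRing.Linear.on avg_map.

Lemma coact_avg_map v : coact V (avg_map v) = tmap avg_map idfun (coact V v).
Proof.
have E (t : tensor V A) : tens_unassoc (tmap idfun comul (tmap pi idfun t))
    = tmap (tmap pi idfun) idfun (tens_unassoc (tmap idfun comul t)).
  elim/tensor_elim: t => [w a|t u IHt IHu]; last by rewrite !tensD IHt IHu.
  rewrite !tmapE /=; elim/tensor_elim: (comul a) => [x y|t u IHt IHu].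
    by rewrite !tens_unassocE !tmapE /= tmapE.
  by rewrite !tensD IHt IHu.
have coassoc := tens_assocK (tmap (coact V) idfun (coact V v)).
rewrite comodule_assoc in coassoc.
have -> : avg_map v = avg (tmap pi idfun (coact V v)) by [].
rewrite coact_avg E coassoc [X in tmap _ _ X]tmap_comp [LHS]tmap_comp.
exact: eq_tmap.
Qed.

End Averaging.

(** * Parity *)

Section Parity.
Variable F : fieldType.
Implicit Types V W U : superType F.

Lemma tens_homog V W p q (v : V) (w : W) :
  v \in homog p -> w \in homog q -> tens v w \in homog (p (+) q).
Proof.
move=> vp wq; apply: mem_lspan; exists p, v, w; split=> //.
by rewrite addbC addbA addbb.
Qed.

Lemma homog_map_tensor V W U r (h : {linear tensor V W -> U}) :
  (forall p q v w, v \in homog p -> w \in homog q ->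
    h (tens v w) \in homog (r (+) (p (+) q))) -> homog_map r h.
Proof.
move=> hr p t; apply: (@lspan_min _ _ _ [pred t | h t \in homog (r (+) p)]).
  split=> [|a x y]; first by rewrite inE linear0 rpred0.
  by rewrite !inE linearP => hx hy; rewrite rpredD ?rpredZ.
move=> _ [q [v [w [vq wq ->]]]]; rewrite inE.
by have := hr _ _ _ _ vq wq; rewrite (addbCA q) addbb addbF.
Qed.

Lemma hcomp_even V W (f : {linear V -> W}) q v :
  even_map f -> hcomp q (f v) = f (hcomp q v).
Proof.
move=> fe; rewrite {1}(hcompD v) !linearD /=.
rewrite !(hcomp_id q (fe _ _ (hcomp_homog _ _))).
by case: q; rewrite /= ?add0r ?addr0.
Qed.

Lemma stens_map_homog V V' W W' p (f : {linear V -> V'}) (g : {linear W -> W'}) :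
  even_map f -> homog_map p g -> homog_map p (stens_map f g).
Proof.
move=> fe gp; apply: homog_map_tensor => q r v w vq wr.
rewrite /= (stens_mapE _ gp vq) rpredZ //.
by rewrite addbCA; apply: tens_homog; [exact: fe | exact: gp].
Qed.

Lemma slice_homog V W p (g : {linear W -> F^o}) :
  homog_map p g -> homog_map p (slice g : tensor V W -> V).
Proof.
move=> gp; apply: homog_map_tensor => q r v w vq wr.
rewrite /= sliceE; have := gp _ _ wr.
have [->|pr] := eqVneq p r; first by rewrite addbCA addbb addbF rpredZ.
have -> : p (+) r = true by move: p r pr {gp wr} => [] [].
by move=> /eqP->; rewrite scale0r rpred0.
Qed.

(** The super tensor product is defined componentwise in its second map; for a
    form I this separates the identity for I into its even and odd parts. *)
Lemma stens_map_hdeg V V' W W' (f : {linear V -> V'}) (g : {linear W -> W'}) t :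
  stens_map f g t = stens_map f (hdeg g false) t + stens_map f (hdeg g true) t.
Proof.
elim/tensor_homog_elim: t => [p q v w vp wq|t u IHt IHu]; last first.
  by rewrite !raddfD /= IHt IHu addrACA.
rewrite !(stens_mapE _ (hdeg_homog _ _) vp) /stens_map tens_liftE /=.
rewrite /stens_map_def !big_bool /= !(hcomp_id _ vp) [RHS]addrC.
have tens0l x : tens (f 0) x = 0 :> tensor V' W' by rewrite linear0 linear0l.
by case: p vp => vp; rewrite /= !tens0l !scaler0 ?addr0 ?add0r.
Qed.

End Parity.

(** * Complements and projections *)

Section Projections.
Variables (F : fieldType).

(** The subspaces meeting W trivially are ordered by inclusion, and Zorn's lemma
    yields a maximal one; a vector outside U + W could be added to a maximal U. *)
Lemma subspace_complement (V : lmodType F) (W : {pred V}) : submod_closed W ->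
  exists2 W' : {pred V}, submod_closed W' &
    (forall v, v \in W -> v \in W' -> v = 0) /\
    (forall v, exists w w', [/\ w \in W, w' \in W' & v = w + w']).
Proof.
move=> [W0 Wl].
(* Containing 0 is not required, because the union of the empty chain has to
   satisfy P; a maximal U contains 0 anyway. *)
pose P (U : set V) := (forall a u v, U u -> U v -> U (a *: u + v)) /\
  (forall u, U u -> u \in W -> u = 0).
have [S SP Stot|U [[Ul UW] Umax]] := @Zorn_bigcup V P.
  split=> [a u v [X SX Xu] [Y SY Yv]|u [X SX Xu]]; last first.
    by have [_ XW] := SP _ SX; apply: XW.
  have [XY|YX] := Stot _ _ SX SY.
    by exists Y => //; have [Yl _] := SP _ SY; apply: Yl => //; apply: XY.
  by exists X => //; have [Xl _] := SP _ SX; apply: Xl => //; apply: YX.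
(* Maximality puts v in U as soon as U + F v still meets W trivially. *)
have Uext v : (forall a x, U x \/ x = 0 -> x + a *: v \in W -> x + a *: v = 0) ->
    U v.
  move=> Uv; pose E u := exists a x, (U x \/ x = 0) /\ u = x + a *: v.
  apply: contrapT => NUv; apply: (Umax [set u | E u]%classic).
    split=> [u Uu|EU]; first by exists 0, u; rewrite scale0r addr0; split; [left|].
    by apply: NUv; apply: EU; exists 1, 0; rewrite scale1r add0r; split; [right|].
  split=> [a _ _ [b [x [Ux ->]]] [c [y [Uy ->]]]|_ [a [x [Ux ->]]]]; last exact: Uv.
  exists (a * b + c), (a *: x + y); split; last first.
    by rewrite scalerDr scalerA addrACA scalerDl.
  case: Ux Uy => [Ux|->] [Uy|->]; rewrite ?addr0 ?scaler0 ?add0r; auto.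
  have U0 : U 0 by have := Ul (-1) x x Ux Ux; rewrite scaleN1r addNr.
  by left; rewrite -[_ *: _]addr0; apply: Ul.
have U0 : U 0.
  apply: Uext => a x [Ux|->]; rewrite scaler0 addr0 //; exact: UW.
exists (fun u => `[< U u >]).
  by split=> [|a u v /asboolP Uu /asboolP Uv]; apply/asboolP => //; apply: Ul.
split=> [v vW /asboolP Uv|v]; first exact: UW.
apply: contrapT => Nv; apply: (Nv); exists 0, v.
split; rewrite ?add0r //; apply/asboolP/Uext => a x Ux xvW.
have {}Ux : U x by case: Ux => // ->.
have [a0|a_neq0] := eqVneq a 0.
  by move: xvW; rewrite a0 scale0r addr0; apply: UW.
case: Nv; exists (a^-1 *: (x + a *: v)), (- a^-1 *: x); split.
- by rewrite -[_ *: _]addr0; apply: Wl.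
- by apply/asboolP; rewrite -[_ *: _]addr0; apply: Ul.
by rewrite scalerDr scalerA mulVf // scale1r scaleNr addrAC subrr add0r.
Qed.

Section Projection.
Variables (V : lmodType F) (W W' : {pred V}).
Hypotheses (Wc : submod_closed W) (Wc' : submod_closed W').
Hypothesis dWW' : forall v, v \in W -> v \in W' -> v = 0.
Hypothesis sWW' : forall v, exists w w', [/\ w \in W, w' \in W' & v = w + w'].

Let proj_exists v : exists w, w \in W /\ v - w \in W'.
Proof. by have [w [w' [ww ww' ->]]] := sWW' v; exists w; rewrite addrC addKr. Qed.

Let proj v := sval (cid (proj_exists v)).

Let projW v : proj v \in W. Proof. by rewrite /proj; case: cid => x []. Qed.
Let projW' v : v - proj v \in W'. Proof. by rewrite /proj; case: cid => x []. Qed.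

Let proj_unique v w : w \in W -> v - w \in W' -> proj v = w.
Proof.
have [_ Wl] := Wc; have [_ Wl'] := Wc'; move=> wW vwW'.
apply/eqP; rewrite -subr_eq0; apply/eqP; apply: dWW'.
  by rewrite addrC -scaleN1r; apply: Wl.
have -> : proj v - w = - 1 *: (v - proj v) + (v - w).
  by rewrite scaleN1r opprB addrA subrK.
exact: Wl'.
Qed.

Let proj_linear : linear proj.
Proof.
have [_ Wl] := Wc; have [_ Wl'] := Wc'; move=> a u v.
apply: proj_unique; first exact: Wl.
by rewrite opprD addrACA -scalerBr; apply: Wl'.
Qed.

(** The component in W is well defined because W and W' meet trivially, hence
    choosing it for each vector gives a linear map. *)
Lemma complement_projection : exists P : {linear V -> V},
  [/\ forall v, P v \in W, forall v, v - P v \in W',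
      forall w, w \in W -> P w = w & forall w, w \in W' -> P w = 0].
Proof.
pose m := GRing.isLinear.Build F V V _ proj proj_linear.
pose P : {linear V -> V} := HB.pack proj m.
exists P; split=> //= w wW; apply: proj_unique => //.
- by rewrite subrr; have [] := Wc'.
- by have [] := Wc.
- by rewrite subr0.
Qed.

End Projection.
End Projections.

(** * Subcomodules *)

Definition kernel (F : fieldType) (V W : lmodType F) (f : V -> W) : {pred V} :=
  [pred v | f v == 0].

Section Subcomodules.
Variables (F : fieldType) (A : hopfSuperAlgType F) (V : rcomodule A).

Lemma graded_hcomp (W : {pred V}) q w :
  graded_subspace W -> w \in W -> hcomp q w \in W.
Proof.
move=> [_ Wg] /Wg [w0 [w1 [[w0W h0] [w1W h1] ->]]].
rewrite linearD /= (hcomp_id q h0) (hcomp_id q h1).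
by case: q; rewrite /= ?add0r ?addr0.
Qed.

Lemma tmap_id_sub (W : {pred V}) (f : {linear V -> V}) t :
  (forall w, w \in W -> f w = w) -> t \in tensor_sub (V := V) W ->
  tmap f idfun t = t.
Proof.
move=> fW /(lspan_min (W := [pred t | tmap f idfun t == t])) H.
apply/eqP; apply: H => [|_ [w wW [a ->]]]; last by rewrite inE tmapE fW.
split=> [|a x y]; first by rewrite inE linear0.
by rewrite !inE tmapP => /eqP-> /eqP->.
Qed.

Lemma tmap_0_sub (W : {pred V}) (f : {linear V -> V}) t :
  (forall w, w \in W -> f w = 0) -> t \in tensor_sub (V := V) W ->
  tmap f idfun t = 0.
Proof.
move=> fW /(lspan_min (W := [pred t | tmap f idfun t == 0])) H.
apply/eqP; apply: H => [|_ [w wW [a ->]]]; last first.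
  by rewrite inE tmapE fW //; apply/eqP/linear0l.
split=> [|a x y]; first by rewrite inE linear0.
by rewrite !inE tmapP => /eqP-> /eqP->; rewrite scaler0 addr0.
Qed.

Lemma slice_sub (W : {pred V}) (g : {linear A -> F^o}) t : submod_closed W ->
  t \in tensor_sub (V := V) W -> slice g t \in W.
Proof.
move=> [W0 Wl] /(lspan_min (W := [pred t | slice g t \in W])); apply.
  split=> [|a x y]; first by rewrite inE linear0.
  by rewrite !inE sliceP; apply: Wl.
by move=> _ [w wW [a ->]]; rewrite inE sliceE -[_ *: _]addr0; apply: Wl.
Qed.

(** In general the kernel of P (x) id has to be identified with ker P (x) A.
    For idempotent P this is immediate: a tensor t killed by P (x) id equals
    ((1 - P) (x) id) t, and 1 - P takes values in ker P. *)
Lemma kernel_subcomodule (P : {linear V -> V}) :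
  even_map P -> (forall v, P (P v) = P v) ->
  (forall v, P v = 0 -> tmap P idfun (coact V v) = 0) ->
  subcomodule (kernel P).
Proof.
move=> Pe PP Pco; split; first split=> [|w /eqP Pw].
- split=> [|a x y]; first by rewrite inE linear0.
  by rewrite !inE linearP => /eqP-> /eqP->; rewrite scaler0 addr0.
- exists (hcomp false w), (hcomp true w).
  by rewrite !inE !hcomp_homog -!hcomp_even // Pw !linear0 eqxx -hcompD.
move=> w /eqP Pw; rewrite -[coact V w]subr0 -(Pco w Pw).
elim/tensor_elim: (coact V w) => [v a|t u IHt IHu]; last first.
  by rewrite tmapD opprD addrACA rpredD.
rewrite tmapE /= -[X in _ - X]/(applyr tens a (P v)) -[tens v a]/(applyr tens a v).
rewrite -linearB; apply: mem_lspan; exists (v - P v); last by exists a.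
by rewrite inE linearB /= PP subrr.
Qed.

Lemma projection_comodule_map (W W' : {pred V}) (P : {linear V -> V}) :
  subcomodule W -> subcomodule W' ->
  (forall v, P v \in W) -> (forall v, v - P v \in W') ->
  (forall w, w \in W -> P w = w) -> (forall w, w \in W' -> P w = 0) ->
  forall v, coact V (P v) = tmap P idfun (coact V v).
Proof.
move=> [_ Wco] [_ Wco'] PW PW' PidW P0W' v.
rewrite -[in RHS](subrK (P v) v) linearD tmapD (tmap_0_sub P0W' (Wco' _ (PW' v))).
by rewrite add0r (tmap_id_sub PidW (Wco _ (PW v))).
Qed.

Lemma projection_even (W W' : {pred V}) (P : {linear V -> V}) :
  graded_subspace W -> graded_subspace W' ->
  (forall v, P v \in W) -> (forall v, v - P v \in W') ->
  (forall w, w \in W -> P w = w) -> (forall w, w \in W' -> P w = 0) ->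
  even_map P.
Proof.
move=> Wg Wg' PW PW' PidW P0W' q v vq.
have {1}-> : v = hcomp q (P v) + hcomp q (v - P v).
  by rewrite -(linearD (hcomp q)) addrCA subrr addr0 /= (hcomp_id _ vq) eqxx.
rewrite linearD /= (PidW _ (graded_hcomp q Wg (PW v))).
by rewrite (P0W' _ (graded_hcomp q Wg' (PW' v))) addr0 hcomp_homog.
Qed.

End Subcomodules.

(** * Complements from a left integral *)

Section IntegralToReducibility.
Variables (F : fieldType) (A : hopfSuperAlgType F).

(** For a homogeneous of parity q, let X_p be the image of Delta(a) under
    id (x) I_p, where I_0 and I_1 are the even and odd parts of I.  Then X_p and
    1 (x) I_p(a) both have parity p + q, and X_0 + X_1 is the sum of the
    1 (x) I_p(a), so that X_0 = 1 (x) I_0(a). *)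
Lemma even_part_left_integral (I : {linear A -> F^o}) :
  left_integral I -> even_left_integral (hdeg I false).
Proof.
move=> II; split=> [|a]; first exact: hdeg_homog.
suff E : stens_map idfun (hdeg I false) (comul a) = tens 1 (hdeg I false a).
  move/(congr1 (slice idfun)): E; rewrite sliceE => <-.
  rewrite stens_map_even; last exact: hdeg_homog.
  by rewrite tmap_slice sliceE scale1r.
elim/homog_ind: a => [q a aq|a b IHa IHb]; last first.
  by rewrite [comul _]linearD [hdeg _ _ _]linearD tensDr [LHS]linearD /= IHa IHb.
have hX p : stens_map idfun (hdeg I p) (comul a) \in homog (p (+) q).
  apply: (stens_map_homog _ (hdeg_homog _ _)) => //; exact: comul_even.
have hY p : tens (1 : A) (hdeg I p a) \in homog (p (+) q).
  by apply: (@tens_homog _ _ _ false); [exact: homog1 | exact: hdeg_homog].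
apply/eqP; rewrite -subr_eq0; apply/eqP; apply: (@homog_eq0 _ _ q).
  by rewrite rpredB ?(hX false) ?(hY false).
have -> : stens_map idfun (hdeg I false) (comul a) - tens 1 (hdeg I false a)
    = tens 1 (hdeg I true a) - stens_map idfun (hdeg I true) (comul a).
  apply/eqP; rewrite subr_eq addrAC eq_sym subr_eq eq_sym -stens_map_hdeg II.
  by rewrite addrC -tensDr -hdegD.
by rewrite rpredB ?(hX true) ?(hY true).
Qed.

Variable I : {linear A -> F^o}.
Hypotheses (I_int : even_left_integral I) (I1 : I 1 = 1).
Variable V : rcomodule A.

(** For a of parity q the form b |-> I(b S(a)) has parity q, and slicing the
    even coaction with it shifts the parity by q. *)
Lemma avg_even : even_map (avg I : tensor V A -> V).
Proof.
have [Ie _] := I_int; apply: homog_map_tensor => p q v a vp aq.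
rewrite /= avgE addbC; apply: slice_homog; last exact: (coact_even vp).
move=> r b br /=; rewrite addbC; apply: (Ie (r (+) q)).
exact: (homogM _ _ _ _ br (antipode_even _ _ aq)).
Qed.

Lemma avg_map_even (pi : {linear V -> V}) :
  even_map pi -> even_map (avg_map I pi).
Proof.
move=> pie p v vp; rewrite /avg_map /=; apply: avg_even.
rewrite -stens_map_even //.
exact: (stens_map_homog pie (even_id (V := A)) (coact_even vp)).
Qed.

Lemma integral_completely_reducible : completely_reducible V.
Proof.
move=> W [Wg Wco]; have [Wc _] := Wg.
have [W' Wc' [dW sW]] := subspace_complement Wc.
have [p [pW _ pid _]] := complement_projection Wc Wc' dW sW.
(* The even part of a projection onto a graded W is still one: W contains the
   homogeneous components of its vectors. *)
pose pi : {linear V -> V} := hdeg p false.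
have piW v : pi v \in W.
  have [W0 Wl] := Wc; rewrite /pi /= /hdeg big_bool /=.
  rewrite -[hcomp true _]scale1r; apply: Wl; exact: graded_hcomp.
have piid w : w \in W -> pi w = w.
  move=> wW; rewrite /pi /= /hdeg big_bool /= !pid; last 2 first.
  - exact: graded_hcomp.
  - exact: graded_hcomp.
  by rewrite !(hcomp_id _ (hcomp_homog _ _)) /= addrC -hcompD.
pose T : {linear V -> V} := avg_map I pi.
have TW v : T v \in W.
  rewrite /T /= /avg_map /=; have [W0 Wl] := Wc.
  elim/tensor_elim: (coact V v) => [w a|t u IHt IHu]; last first.
    by rewrite tmapD avgD -[avg _ _]scale1r; apply: Wl.
  by rewrite tmapE avgE; apply: slice_sub => //; apply: Wco.
have Tid w : w \in W -> T w = w.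
  move=> wW; rewrite /T /= /avg_map /= (tmap_id_sub piid (Wco _ wW)).
  by rewrite avg_coact // I1 scale1r.
exists (kernel T).
  apply: kernel_subcomodule => [|v|v Tv].
  - by apply: avg_map_even; apply: hdeg_homog.
  - by rewrite Tid.
  by rewrite -(coact_avg_map I_int) -[avg_map _ _ v]/(T v) Tv linear0.
split=> [v vW /eqP Tv|v]; first by rewrite -(Tid v vW).
exists (T v), (v - T v); split=> //; last by rewrite addrC subrK.
by rewrite inE linearB /= (Tid _ (TW v)) subrr.
Qed.

End IntegralToReducibility.

(** * A left integral from complements *)

Section ReducibilityToIntegral.
Variables (F : fieldType) (A : hopfSuperAlgType F).

Definition regular_comodule : rcomodule A :=
  @RComodule F A A comul comul_even comulA counitr.

(** The line F 1; the coefficient of a scalar is recovered by the counit. *)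
Definition scalars : {pred A} := [pred a | a == line 1 (counit a)].

Lemma scalarsP a : a \in scalars -> a = (counit a : F) *: 1.
Proof. by move/eqP. Qed.

Lemma scalars1 : 1 \in scalars.
Proof. by rewrite inE counit1 /line scale1r. Qed.

Lemma scalars_subcomodule : subcomodule (V := regular_comodule) scalars.
Proof.
have S0 : 0 \in scalars by rewrite inE !linear0.
split; first split=> [|w wS].
- split=> // c x y /eqP xS /eqP yS.
  by rewrite inE !linearP /= -xS -yS.
- exists w, 0; split; rewrite ?addr0 ?rpred0 //; split=> //.
  by rewrite (scalarsP wS) rpredZ ?homog1.
move=> w wS; rewrite (scalarsP wS) linearZ /= rpredZ // comul1.
by apply: mem_lspan; exists 1; [exact: scalars1 | exists 1].
Qed.

(** The projection P onto the scalars along a complementary subcomodule is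
    colinear; write P(a) = I(a) 1 with I = e P and apply the counit to the left
    factor of Delta(P(a)) = P(a_1) (x) a_2. *)
Lemma even_right_integral_exists : completely_reducible regular_comodule ->
  exists I : {linear A -> F^o}, [/\ even_map I, I 1 = 1 &
    forall a, lslice I (comul a) = (I a : F) *: 1].
Proof.
move=> cr; have [W' W'co [dW sW]] := cr _ scalars_subcomodule.
have [[[Sc Sg] Sco] [[Wc Wg] Wco]] := (scalars_subcomodule, W'co).
have [P [PS PW' Pid P0]] := complement_projection Sc Wc dW sW.
have Pe := projection_even (V := regular_comodule) (conj Sc Sg) (conj Wc Wg)
  PS PW' Pid P0.
exists (counit \o P); split=> [p a ap||a] /=.
- exact: (counit_even _ _ (Pe _ _ ap)).
- by rewrite Pid ?scalars1 ?counit1.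
have := projection_comodule_map scalars_subcomodule W'co PS PW' Pid P0 a.
move/(congr1 (lslice counit)); rewrite lslice_counit lslice_tmap /= => <-.
exact: scalarsP (PS a).
Qed.

Lemma linear_slice_lslice (I J : {linear A -> F^o}) t :
  I (slice J t) = J (lslice I t).
Proof.
elim/tensor_elim: t => [x y|t u IHt IHu].
  by rewrite sliceE lsliceE !linearZ /= [LHS]mulrC.
by rewrite sliceD lsliceD !linearD IHt IHu.
Qed.

Lemma tmap_line (I : {linear A -> F^o}) (u : A) (t : tensor A A) :
  tmap idfun (line u \o I) t = tens (slice I t) u.
Proof.
elim/tensor_elim: t => [x y|t t' IHt IHt']; last by rewrite !tensD IHt IHt'.
by rewrite tmapE sliceE /= /line tensZl tensZr.
Qed.

Variable I : {linear A -> F^o}.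
Hypotheses (Ie : even_map I) (I1 : I 1 = 1).
Hypothesis I_right : forall a, lslice I (comul a) = (I a : F) *: 1.

(** The action a |-> a_1 I(a_2) of I on A as an element of the dual algebra. *)
Definition hit (a : A) : A := slice I (comul a).
HB.instance Definition _ := GRing.Linear.copy hit (slice I \o comul).

Lemma comul_hit a : comul (hit a) = tmap idfun hit (comul a).
Proof.
rewrite /hit linear_slice -slice_assoc comul_assoc tmap_comp.
exact: eq_tmap.
Qed.

Lemma hit_even : even_map hit.
Proof.
by move=> p a ap; apply: (slice_homog Ie (comul_even _ _ ap)).
Qed.

(** I is idempotent in the dual algebra: right invariance gives
    I(a_1) I(a_2) = I(a) I(1) = I(a). *)
Lemma hit_id a : hit (hit a) = hit a.
Proof.
rewrite {1}/hit comul_hit slice_tmap; apply: eq_slice => x /=.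
by rewrite /hit linear_slice_lslice I_right linearZ /= I1 [LHS]mulr1.
Qed.

(** Both sides are a_1 (x) I(a_2) a_3. *)
Lemma tmap_hit a : tmap hit idfun (comul a) = tens (hit a) 1.
Proof.
have -> : tmap hit idfun (comul a)
    = tmap (slice I) idfun (tmap comul idfun (comul a)).
  by rewrite tmap_comp; apply: eq_tmap.
rewrite slice_lslice_assoc comul_assoc tmap_comp -tmap_line.
by apply: eq_tmap => // x; rewrite /= I_right.
Qed.

(** A complementary subcomodule of the kernel of the action of I consists of
    coinvariants, and in A the only coinvariants are the scalars. *)
Lemma right_integral_is_left : completely_reducible regular_comodule ->
  forall a, slice I (comul a) = (I a : F) *: 1.
Proof.
move=> cr a.
have Kco : subcomodule (V := regular_comodule) (kernel hit).
  apply: (kernel_subcomodule (V := regular_comodule) hit_even hit_id) => v v0.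
  by rewrite [LHS]tmap_hit v0 linear0l.
have [W Wco [dK sK]] := cr _ Kco.
have dW v : v \in W -> v \in kernel hit -> v = 0 by move=> ? ?; apply: dK.
have sW v : exists w w', [/\ w \in W, w' \in kernel hit & v = w + w'].
  by have [w [w' [? ? ->]]] := sK v; exists w', w; rewrite addrC.
have [[[Kc _] _] [[Wc _] _]] := (Kco, Wco).
have [Q [QW QK Qid Q0]] := complement_projection Wc Kc dW sW.
have Qhit b : Q b = Q (hit b).
  apply/eqP; rewrite -subr_eq0 -linearB; apply/eqP/Q0.
  by rewrite inE linearB /= hit_id subrr.
have comulQ b : comul (Q b) = tens (Q b) 1.
  have -> := projection_comodule_map Wco Kco QW QK Qid Q0 b.
  have -> : tmap Q idfun (comul b) = tmap Q idfun (tmap hit idfun (comul b)).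
    by rewrite tmap_comp; apply: eq_tmap.
  by rewrite tmap_hit tmapE -Qhit.
have Qscalar b : Q b = (counit (Q b) : F) *: 1.
  by rewrite -[LHS]lslice_counit comulQ lsliceE.
have hitQ b : hit b = Q b.
  have /eqP := QK b; rewrite linearB /= => /subr0_eq->.
  by rewrite /hit comulQ sliceE I1 scale1r.
rewrite -/(hit a) hitQ Qscalar -hitQ /hit linear_slice_lslice.
by rewrite lslice_counit.
Qed.

Lemma left_integralP (J : {linear A -> F^o}) : even_map J ->
  (forall a, slice J (comul a) = (J a : F) *: 1) -> left_integral J.
Proof.
move=> Je Jl a; rewrite stens_map_even // tmap_slice Jl tensZl -tensZr.
by rewrite [_ *: _]mulr1.
Qed.

End ReducibilityToIntegral.

Theorem proposition2 (R : realType) (A : hopfSuperAlgType R[i]) :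
  (exists I : {linear A -> R[i]^o}, left_integral I /\ I 1 != 0) <->
  (forall V : rcomodule A, completely_reducible V).
Proof.
split=> [[I [II I1]] V|cr].
  have [I0e I0l] := even_part_left_integral II.
  have I01 : hdeg I false 1 = I 1.
    have := hdegD I 1; rewrite [X in _ = _ + X](_ : _ = 0) ?addr0 //.
    by have /eqP := hdeg_homog I true homog1.
  pose J : {linear A -> R[i]^o} := (I 1)^-1 \*: hdeg I false.
  apply: (@integral_completely_reducible _ _ J); last first.
    by rewrite /= I01 [LHS]mulVf.
  split=> [p a ap /=|a]; first by rewrite rpredZ // I0e.
  rewrite /= -scalerA -I0l.
  elim/tensor_elim: (comul a) => [x y|t u IHt IHu].
    by rewrite !sliceE /= scalerA.
  by rewrite !sliceD IHt IHu scalerDr.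
have [I [Ie I1 Ir]] := even_right_integral_exists (cr _).
exists I; rewrite I1 oner_neq0; split=> //; apply: left_integralP => //.
exact: (right_integral_is_left Ie I1 Ir (cr _)).
Qed.
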